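(* Let $X$ be a set, $p\ge 2$, $f:X\to\mathbb{R}^p$, let $Y\subseteq\mathbb{R}^p$ be a set containing $f(X)$, let $g:Y\to\mathbb{R}\cup\{+\infty\}$ be a lower semi-continuous function and let $\epsilon\in\mathbb{R}^p$. If the scalar problem $$\min\ g(f(x))\quad\text{s.t. } x\in X,\ f(x)\leqq\epsilon,$$ is unbounded (i.e., its objective is unbounded below on its feasible set), then the multi-objective problem $\min\{f(x):x\in X\}$ does not have any properly efficient solution.
   Context: Notation: $\mathbb{R}^p_+$ is the nonnegative orthant; $x\leqq y$ means $y-x\in\mathbb{R}^p_+$. Proper efficiency for $\min\{f(x):x\in X\}$, $f:X\to\mathbb{R}^p$: a point $\bar x\in X$ is efficient if there is no $x\in X$ with $f_i(x)\le f_i(\bar x)$ for all $i$ and $f_j(x)<f_j(\bar x)$ for some $j$. The point $\bar x$ is properly efficient (Geoffrion) if it is efficient and there is a real $M>0$ such that for all $i\in\{1,\dots,p\}$ and $x\in X$ with $f_i(x)<f_i(\bar x)$ there is $j\in\{1,\dots,p\}$ with $f_j(x)>f_j(\bar x)$ and $\frac{f_i(\bar x)-f_i(x)}{f_j(x)-f_j(\bar x)}\le M$. Equivalent definitions, used interchangeably: (Benson) $\mathrm{cl}\big(\mathrm{cone}(f(X)+\mathbb{R}^p_+-f(\bar x))\big)\cap(-\mathbb{R}^p_+)=\{0\}$, where $\mathrm{cone}$ is the conic hull; (Henig) there is a convex pointed cone $C$ with $\mathbb{R}^p_+\setminus\{0\}\subseteq\mathrm{int}(C)$ and $f(X)\cap(f(\bar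 x)-C)=\{f(\bar x)\}$.
   Formalization: Lower semi-continuity of g is required of its extension by +∞ to all of R^p (automatic for closed Y); with lower semi-continuity relative to Y only, the claim fails, e.g. g = −1/y₁ on X = Y = {(t,1−t): 0<t≤1}, f = id. *)

(* Defs.v *)
From HB Require Import structures.
From mathcomp Require Import all_boot all_order all_algebra.
From mathcomp Require Import all_classical all_reals all_analysis.
Set Implicit Arguments.
Unset Strict Implicit.
Unset Printing Implicit Defensive.
Import Order.TTheory GRing.Theory Num.Theory.
Import numFieldNormedType.Exports.
Local Open Scope classical_set_scope.
Local Open Scope ring_scope.

Section MultiObjective.
Variables (R : realType) (p : nat) (T : Type).
Implicit Types (X : set T) (f : T -> 'rV[R]_p) (Y : set 'rV[R]_p).

Definition leqq (y z : 'rV[R]_p) : Prop :=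
  forall i : 'I_p, y ord0 i <= z ord0 i.

Definition efficient X f (xbar : T) : Prop :=
  X xbar /\
  ~ exists2 x, X x & leqq (f x) (f xbar) /\
                     exists j : 'I_p, f x ord0 j < f xbar ord0 j.

(* Proper efficiency in the sense of Geoffrion. *)
Definition properly_efficient X f (xbar : T) : Prop :=
  efficient X f xbar /\
  exists2 M : R, 0 < M &
    forall (i : 'I_p) (x : T), X x -> f x ord0 i < f xbar ord0 i ->
      exists2 j : 'I_p, f xbar ord0 j < f x ord0 j &
        (f xbar ord0 i - f x ord0 i) / (f x ord0 j - f xbar ord0 j) <= M.

Definition unbounded_below X (h : T -> \bar R) : Prop :=
  forall a : R, exists2 x, X x & (h x < a%:E)%E.

(* The values of g outside Y are irrelevant.  Following the usual convention
   for functions with values in ]-oo, +oo], semi-continuity on Y refers to the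
   extension of g by +oo to the whole space; equivalently, every sublevel set
   {y in Y | g y <= a} is closed in the whole space.  If Y is closed this is
   semi-continuity for the subspace topology of Y.  If Y is not closed the
   subspace notion would be too weak: -1/y_1 is continuous on the segment
   {(t, 1 - t) | 0 < t <= 1} and unbounded below there, although every point of
   that segment is properly efficient. *)
Definition lsc_on Y (g : 'rV[R]_p -> \bar R) : Prop :=
  @lower_semicontinuous 'rV[R]_p R (patch (fun=> +oo%E) Y g).

End MultiObjective.

(* Main.v *)
(* Geoffrion's condition bounds f x from below on the feasible set: if
   f_i x < f_i xbar, then some j satisfies
   f_i xbar - f_i x <= M (f_j x - f_j xbar) <= M (eps_j - f_j xbar).
   The feasible values thus lie in a compact box, on which the lower
   semi-continuous g is bounded below. *)
Require Import Defs.
From HB Require Import structures.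
From mathcomp Require Import all_boot all_order all_algebra.
From mathcomp Require Import all_classical all_reals all_analysis.
Set Implicit Arguments.
Unset Strict Implicit.
Unset Printing Implicit Defensive.
Import Order.TTheory GRing.Theory Num.Theory.
Import numFieldNormedType.Exports.
Local Open Scope classical_set_scope.
Local Open Scope ring_scope.

(** Around each [y] in [K], [h] stays above some real [b < h y], hence above every [a < b]. The
    near-covering form of compactness, applied to the filter of neighborhoods of [-oo], turns these
    local bounds into one [a] valid on all of [K]. *)
Lemma lower_semicontinuous_compact_lbound (R : realType)
    (S : topologicalType) (h : S -> \bar R) (K : set S) :
  compact K -> lower_semicontinuous h -> (forall y, K y -> h y <> -oo%E) ->
  exists a : R, forall y, K y -> (a%:E <= h y)%E.
Proof.
move=> /compact_near_coveringP Kcov hlsc hNy.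
suff [a Ka] : exists a : R, K `<=` (fun y => (a%:E <= h y)%E).
  by exists a.
apply: (@filter_ex _ (ninfty_nbhs R)).
apply: (Kcov R (ninfty_nbhs R) (fun a y => (a%:E <= h y)%E)) => y Ky.
have [b bhy] : exists b : R, (b%:E < h y)%E.
  case: (h y) (hNy y Ky) => [r _| _|//]; last by exists 0; rewrite ltry.
  by exists (r - 1); rewrite lte_fin gtrBl.
have [V Vy Vh] := hlsc _ _ bhy.
exists (V, [set a | a < b]) => /=; first by split => //; apply/nbhs_ninfty_lt/num_real.
move=> [z a] [/= Vz ab]; apply/ltW/(lt_trans _ (Vh z Vz)).
by rewrite lte_fin.
Qed.

Lemma geoffrion_lbound (R : realType) (p : nat) (T : Type) (X : set T)
    (f : T -> 'rV[R]_p) (xbar : T) (eps : 'rV[R]_p) :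
  properly_efficient X f xbar ->
  exists B : R, forall x i, X x -> leqq (f x) eps ->
    f xbar ord0 i - B <= f x ord0 i.
Proof.
move=> [_ [M M0 HM]].
pose d j := eps ord0 j - f xbar ord0 j.
have S0 : 0 <= \sum_j `|d j| by apply: sumr_ge0.
(* The index [j] given by Geoffrion's condition varies with [x] and [i]; the sum of absolute values
   dominates every [d j], and its nonnegativity settles the case where [f x] is not below [f xbar]
   at [i]. *)
exists (M * \sum_j `|d j|) => x i Xx xeps.
have [fi|fi] := ltP (f x ord0 i) (f xbar ord0 i); last first.
  by rewrite lerBlDr (le_trans fi)// lerDl mulr_ge0// ltW.
have [j fj] := HM i x Xx fi.
rewrite ler_pdivrMr ?subr_gt0// lerBlDr addrC -lerBlDr; apply: le_trans.
rewrite lerB// ler_pM2l//.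
have : f x ord0 j - f xbar ord0 j <= d j by rewrite lerB// xeps.
move/le_trans; apply; rewrite (le_trans (ler_norm _))//.
by rewrite (bigD1 j)//= lerDl sumr_ge0.
Qed.

Theorem theorem3p3 (R : realType) (p : nat) (T : Type) (X : set T)
    (f : T -> 'rV[R]_p) (Y : set 'rV[R]_p) (g : 'rV[R]_p -> \bar R)
    (eps : 'rV[R]_p) :
  (2 <= p)%N ->
  f @` X `<=` Y ->
  (forall y, Y y -> g y <> -oo%E) ->
  lsc_on Y g ->
  unbounded_below [set x | X x /\ leqq (f x) eps] (g \o f) ->
  ~ exists xbar, properly_efficient X f xbar.
Proof.
move=> _ fXY gNy glsc gunb [xbar fxbar].
have [B fB] := geoffrion_lbound eps fxbar.
pose I i := `[f xbar ord0 i - B, eps ord0 i]%classic.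
have cK := rV_compact (fun i => @segment_compact R _ _ : compact (I i)).
(* The box may leave [Y], so the bound is taken for the extension of [g] by [+oo], which still
   avoids [-oo] and agrees with [g] at [f x]. *)
have [|a ag] := lower_semicontinuous_compact_lbound cK glsc.
  by move=> y _; rewrite /patch; case: ifPn => // /set_mem; exact: gNy.
have [x [Xx xeps]] := gunb a.
have /ag : forall i, I i (f x ord0 i) by move=> i; rewrite /I /= in_itv /= fB//= xeps.
rewrite patchT; last by apply/mem_set/fXY; exists x.
by move=> /le_lt_trans /[apply]; rewrite ltxx.
Qed.
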